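(* Let $N\in\mathbb{N}_+$ and an integer $\ell_N\ge2$ be fixed. For every $\eta\in\Omega_N$, $$\lim_{m\nearrow1}r_N^{(m-1)}(\eta)=\mathbf{r}^{(0)}(\eta)=\lim_{m\searrow1}r_N^{(m-1)}(\eta)\qquad\text{and}\qquad \lim_{m\nearrow2}r_N^{(m-1)}(\eta)=\mathbf{r}^{(1)}(\eta).$$
   Context: $\mathbb{T}_N=\mathbb{Z}/N\mathbb{Z}$, $\Omega_N=\{0,1\}^{\mathbb{T}_N}$; sites are read modulo $N$; $\overline{\eta}(x)=1-\eta(x)$. Put $\mathbf{a}(\eta)=\eta(0)(1-\eta(1))+\eta(1)(1-\eta(0))$. For integers $k\ge0$ and $1\le j\le k+1$, $$\mathbf{s}^{(k)}_j(\eta)=\prod_{\substack{i=-(k+1)+j\\ i\ne0,1}}^{j}\eta(i),\qquad \mathbf{c}^{(k)}(\eta)=\sum_{j=1}^{k+1}\mathbf{s}_j^{(k)}(\eta),\qquad \mathbf{r}^{(k)}(\eta)=\mathbf{c}^{(k)}(\eta)\mathbf{a}(\eta)$$ (product over integers $i$; $\mathbf{c}^{(0)}\equiv1$). $\mathbf{r}^{(k)}$ is the exchange rate at the edge $\{0,1\}$ in the porous medium model PMM($k$); PMM(0) is the symmetric simple exclusion process. With $\binom{m}{k}=\frac{m(m-1)\cdots(m-k+1)}{k!}$, for $m\in[0,2]$, $$r_N^{(m-1)}(\eta)=\mathbf{a}(\eta)\sum_{k=1}^{\ell_N}\binom{m}{k}(-1)^{k-1}\mathbf{c}^{(k-1)}(\overline{\eta}).$$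 *)

(* Defs.v *)
From mathcomp Require Import all_boot all_order all_algebra.
From mathcomp Require Import all_classical all_reals all_analysis.
Set Implicit Arguments.
Unset Strict Implicit.
Unset Printing Implicit Defensive.
Import Order.TTheory GRing.Theory Num.Theory.
Local Open Scope ring_scope.

(* T_N is represented by 'I_N and not by 'Z_N, which is Z/2Z for N = 1. *)
Definition config (N : nat) : Type := {ffun 'I_N -> bool}.

Lemma absz_modz_lt (N : nat) (N_gt0 : (0 < N)%N) (x : int) :
  (`|(x %% N)%Z| < N)%N.
Proof.
by rewrite -ltz_nat gez0_abs ?ltz_pmod ?modz_ge0 // gt_eqF.
Qed.

Definition site (N : nat) (N_gt0 : (0 < N)%N) (x : int) : 'I_N :=
  Ordinal (absz_modz_lt N_gt0 x).

Definition occ (R : realType) (N : nat) (N_gt0 : (0 < N)%N)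
    (eta : config N) (x : int) : R := (eta (site N_gt0 x))%:R.

Definition flip (N : nat) (eta : config N) : config N := [ffun x => ~~ eta x].

Definition exch (R : realType) (N : nat) (N_gt0 : (0 < N)%N)
    (eta : config N) : R :=
  occ R N_gt0 eta 0 * (1 - occ R N_gt0 eta 1)
  + occ R N_gt0 eta 1 * (1 - occ R N_gt0 eta 0).

(* For t = 0, ..., k + 1 this runs through the integers from -(k+1)+j to j. *)
Definition window (k j t : nat) : int := - (k.+1)%:Z + j%:Z + t%:Z.

Definition pmm_s (R : realType) (N : nat) (N_gt0 : (0 < N)%N) (k j : nat)
    (eta : config N) : R :=
  \prod_(t < k.+2 | (window k j t != 0) && (window k j t != 1))
    occ R N_gt0 eta (window k j t).

Definition pmm_c (R : realType) (N : nat) (N_gt0 : (0 < N)%N) (k : nat)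
    (eta : config N) : R :=
  \sum_(1 <= j < k.+2) pmm_s R N_gt0 k j eta.

Definition pmm_rate (R : realType) (N : nat) (N_gt0 : (0 < N)%N) (k : nat)
    (eta : config N) : R :=
  pmm_c R N_gt0 k eta * exch R N_gt0 eta.

Definition gbinom (R : realType) (m : R) (k : nat) : R :=
  (\prod_(i < k) (m - i%:R)) / (k`!)%:R.

(* interp_rate N_gt0 l m eta is r_N^{(m-1)}(eta), with l standing for ell_N:
   the argument is m, not the superscript m - 1. *)
Definition interp_rate (R : realType) (N : nat) (N_gt0 : (0 < N)%N) (l : nat)
    (m : R) (eta : config N) : R :=
  exch R N_gt0 eta
  * \sum_(1 <= k < l.+1)
      gbinom m k * (-1) ^+ k.-1 * pmm_c R N_gt0 k.-1 (flip eta).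

(* Main.v *)
(* At fixed [eta] the rate is a polynomial in [m], so each one-sided limit is
   its value at the end point.  At an integer [n] the binomials with [k > n]
   vanish: [n = 1] leaves c^(0) = 1, while [n = 2] leaves
   2 - ((1 - eta(-1)) + (1 - eta(2))) = eta(-1) + eta(2) = c^(1)(eta). *)
Require Import Defs.
From mathcomp Require Import all_boot all_order all_algebra.
From mathcomp Require Import all_classical all_reals all_analysis.
From mathcomp Require Import ring.
Import Order.TTheory GRing.Theory Num.Theory.
Import numFieldNormedType.Exports.
Local Open Scope classical_set_scope.
Local Open Scope ring_scope.

(** The numerator is the falling factorial [n ^_ k], which equals ['C(n, k) * k!]. *)
Lemma gbinom_nat (R : realType) (n k : nat) :
  gbinom (n%:R : R) k = 'C(n, k)%:R.
Proof.
have prodE : \prod_(i < k) (n%:R - i%:R : R) = (n ^_ k)%:R.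
  elim: k => [|k IHk]; first by rewrite big_ord0 ffactn0.
  rewrite big_ord_recr /= IHk ffactnSr natrM.
  (* Truncated [n - k] agrees with the subtraction in [R] only for [k <= n]; beyond that
     [n ^_ k = 0] kills both sides. *)
  have [le_kn|lt_nk] := leqP k n; first by rewrite natrB.
  by rewrite ffact_small // !mul0r.
by rewrite /gbinom prodE -bin_ffact natrM mulfK ?pnatr_eq0 -?lt0n ?fact_gt0.
Qed.

Lemma continuous_gbinom (R : realType) (k : nat) :
  continuous (fun m : R => gbinom m k).
Proof.
move=> m; apply: cvgM; last exact: cvg_cst.
apply: cvg_big => [|i _]; first exact: mul_continuous.
by apply: cvgB; [exact: cvg_id|exact: cvg_cst].
Qed.

Lemma continuous_interp_rate (R : realType) (N : nat) (N_gt0 : (0 < N)%N)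
    (l : nat) (eta : config N) :
  continuous (fun m : R => interp_rate N_gt0 l m eta).
Proof.
move=> m; apply: cvgM; first exact: cvg_cst.
apply: cvg_big => [|k _]; first exact: add_continuous.
apply: cvgM; last exact: cvg_cst.
by apply: cvgM; [exact: continuous_gbinom|exact: cvg_cst].
Qed.

Lemma interp_rate_nat (R : realType) (N : nat) (N_gt0 : (0 < N)%N)
    (l n : nat) (eta : config N) : (n <= l)%N ->
  interp_rate N_gt0 l (n%:R : R) eta =
  exch R N_gt0 eta * \sum_(1 <= k < n.+1)
    'C(n, k)%:R * (-1) ^+ k.-1 * pmm_c R N_gt0 k.-1 (flip eta).
Proof.
move=> le_nl; rewrite /interp_rate; congr (_ * _).
(* The tail keeps its range as a condition, so that [n < k] is at hand to make ['C(n, k)] vanish. *)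
rewrite (big_cat_nat (n := n.+1)) //= [X in _ + X]big_nat_cond.
rewrite [X in _ + X]big1 ?addr0.
  by apply: eq_bigr => k _; rewrite gbinom_nat.
move=> k /andP[/andP[lt_nk _] _].
by rewrite gbinom_nat bin_small // !mul0r.
Qed.

(** The only window is [{0, 1}], whose sites are both excluded: the product is empty. *)
Lemma pmm_c0 (R : realType) (N : nat) (N_gt0 : (0 < N)%N) (eta : config N) :
  pmm_c R N_gt0 0 eta = 1.
Proof. by rewrite /pmm_c big_nat1 /pmm_s big1 // => -[[|[|t]] ht]. Qed.

(** The windows are [{-1, 0, 1}] and [{0, 1, 2}]; each keeps one site. The exclusion tests integers
    before reduction modulo [N], so small [N] needs no separate case. *)
Lemma pmm_c1 (R : realType) (N : nat) (N_gt0 : (0 < N)%N) (eta : config N) :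
  pmm_c R N_gt0 1 eta = occ R N_gt0 eta (-1) + occ R N_gt0 eta 2.
Proof.
rewrite /pmm_c big_nat_recl // big_nat1 /pmm_s.
by congr (_ + _); rewrite big_mkcond !big_ord_recl big_ord0 /= ?mul1r !mulr1.
Qed.

Lemma occ_flip (R : realType) (N : nat) (N_gt0 : (0 < N)%N) (eta : config N)
    (x : int) :
  occ R N_gt0 (flip eta) x = 1 - occ R N_gt0 eta x.
Proof. by rewrite /occ ffunE; case: (eta _); rewrite ?subrr ?subr0. Qed.

Theorem proposition2p13 (R : realType) (N : nat) (N_gt0 : (0 < N)%N)
    (l : nat) (l_ge2 : (2 <= l)%N) (eta : config N) :
  (interp_rate N_gt0 l m eta @[m --> (1 : R)^'-] --> pmm_rate R N_gt0 0 eta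
   /\ interp_rate N_gt0 l m eta @[m --> (1 : R)^'+] --> pmm_rate R N_gt0 0 eta)
  /\ interp_rate N_gt0 l m eta @[m --> (2 : R)^'-] --> pmm_rate R N_gt0 1 eta.
Proof.
have rate1 : interp_rate N_gt0 l 1 eta = pmm_rate R N_gt0 0 eta.
  rewrite (interp_rate_nat _ _ _ _ 1) ?(ltnW l_ge2) // big_nat1.
  by rewrite /pmm_rate !pmm_c0 bin1 expr0 !mulr1 mul1r.
have rate2 : interp_rate N_gt0 l 2 eta = pmm_rate R N_gt0 1 eta.
  rewrite (interp_rate_nat _ _ _ _ 2) // big_nat_recl // big_nat1 /=.
  by rewrite /pmm_rate pmm_c0 !pmm_c1 !occ_flip bin1 binn; ring.
(* With the targets rewritten as values at 1 and 2, two-sided continuity restricts to each side. *)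
by rewrite -rate1 -rate2; split; [split|];
  [apply: cvg_at_left_filter|apply: cvg_at_right_filter
  |apply: cvg_at_left_filter]; exact: continuous_interp_rate.
Qed.
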